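(* Let $\mathcal{E}_t$ be the series of flows on rooted trees, $\mathcal{E}^c_t$ the series of connected flows, and $\mathcal{E}^c$ the value of $\mathcal{E}^c_t$ at $t=0$. Then $$\mathcal{E}_t=\Big(\sum_T\frac{T}{\mathrm{aut}(T)}\Big)\diamond(\mathcal{E}^c_t,\mathcal{E}^c),$$ where the sum runs over isomorphism classes of rooted trees.
   Context: A rooted tree $T$ is a finite tree with a distinguished vertex (the root), edges oriented towards the root; $w\to v$ means that $w$ is a child of $v$. A flow on $T$ of size $k$ is a set $O$ of $k$ vertices (outputs) and a function $m:V(T)\to\mathbb{N}$ vanishing on $O$ (inputs with multiplicity are the vertices with $m>0$) such that the rates $r(v)\in\mathbb{Z}$ determined by $r(v)=m(v)-[v\in O]+\sum_{w\to v}r(w)$ are all $\ge 0$. Here $r(v)$ is the rate of the edge going out of $v$; the exit rate is $r(\mathrm{root})$. A flow is connected if every edge has strictly positive rate, i.e. $r(v)\ge1$ for every non-root vertex $v$. Let $\mathcal{E}_{T,t}=\sum b^{\text{size}}t^{\text{exit rate}}\in\mathbb{Q}[b][[t]]$ over all flows on $T$, $\mathcal{E}^c_{T,t}$ the same sum over connected flows on $T$, and $\mathcal{E}_t=\sum_T\mathcal{E}_{T,t}\,T/\mathrm{aut}(T)$, $\mathcal{E}^c_t=\sum_T\mathcal{E}^c_{T,t}\,T/\mathrm{aut}(T)$, sums over isomorphism classes of rooted trees, $\mathrm{aut}(T)$ being the number of automorphisms of $T$. **Operation $\diamond$ (from the Pre-Lie operad).** If $S$ is a rooted tree with vertex set $\{1,\dots,m\}$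 and root $1$, and $T_1,\dots,T_m$ are rooted trees, let $S(T_1,\dots,T_m)$ be the sum, over all ways to choose for each edge $i\to j$ of $S$ a vertex of $T_j$, of the rooted tree obtained from the disjoint union of the $T_i$ by joining, for each edge $i\to j$ of $S$, the root of $T_i$ to the chosen vertex of $T_j$; the root is that of $T_1$. This is extended multilinearly to formal series in each $T_i$. For series $t,u$ of rooted trees, $S\diamond(t,u)=S(t,u,\dots,u)$ ($t$ at the root, $u$ at all other vertices), extended linearly to series in $S$. *)

(* Defs.v *)
From HB Require Import structures.
From mathcomp Require Import all_boot all_order all_algebra perm.
From mathcomp Require Import all_classical.

Set Implicit Arguments.
Unset Strict Implicit.
Unset Printing Implicit Defensive.

Import Order.TTheory GRing.Theory Num.Theory.
Local Open Scope ring_scope.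
Local Open Scope quotient_scope.

(** * Formal power series R[[t]] *)

Record fps (R : Type) := Fps { fps_coef : nat -> R }.

Lemma fpsP (R : Type) (a b : fps R) : fps_coef a =1 fps_coef b -> a = b.
Proof. by case: a b => [a] [b] /= /funext ->. Qed.

HB.instance Definition _ (R : Type) := gen_eqMixin (fps R).
HB.instance Definition _ (R : Type) := gen_choiceMixin (fps R).

Section FpsRing.
Variable R : comNzRingType.
Implicit Types a b c : fps R.

Definition fpsC (x : R) : fps R := Fps (fun n => if n is 0%N then x else 0).
Definition fps_add a b : fps R := Fps (fun n => fps_coef a n + fps_coef b n).
Definition fps_opp a : fps R := Fps (fun n => - fps_coef a n).
Definition fps_mul a b : fps R :=
  Fps (fun n => \sum_(i < n.+1) fps_coef a i * fps_coef b (n - i)%N).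

Let fps_addA : associative fps_add.
Proof. by move=> a b c; apply: fpsP => n /=; rewrite addrA. Qed.
Let fps_addC : commutative fps_add.
Proof. by move=> a b; apply: fpsP => n /=; rewrite addrC. Qed.
Let fps_add0 : left_id (fpsC 0) fps_add.
Proof. by move=> a; apply: fpsP => -[|n] /=; rewrite add0r. Qed.
Let fps_addN : left_inverse (fpsC 0) fps_opp fps_add.
Proof. by move=> a; apply: fpsP => -[|n] /=; rewrite addNr. Qed.

HB.instance Definition _ :=
  GRing.isZmodule.Build (fps R) fps_addA fps_addC fps_add0 fps_addN.

Let trunc n a : {poly R} := \poly_(i < n.+1) fps_coef a i.

Let coef_trunc n a i : (i <= n)%N -> (trunc n a)`_i = fps_coef a i.
Proof. by move=> le_in; rewrite coef_poly ltnS le_in. Qed.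

Let coef_truncM n a b i :
  (i <= n)%N -> (trunc n a * trunc n b)`_i = fps_coef (fps_mul a b) i.
Proof.
move=> le_in; rewrite coefM /=; apply: eq_bigr => -[j /= lt_ji] _.
by rewrite !coef_trunc // (leq_trans _ le_in) ?leq_subr.
Qed.

Let fps_mulC : commutative fps_mul.
Proof.
by move=> a b; apply: fpsP => n; rewrite -!(@coef_truncM n) // mulrC.
Qed.

Let fps_mulA : associative fps_mul.
Proof.
move=> a b c; apply: fpsP => n.
transitivity (trunc n a * trunc n b * trunc n c)`_n.
  rewrite -mulrA coefM /=; apply: eq_bigr => -[j /= lt_jn] _.
  by rewrite coef_trunc // coef_truncM // leq_subr.
rewrite coefM /=; apply: eq_bigr => -[j /= lt_jn] _.
by rewrite coef_truncM // coef_trunc // leq_subr.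
Qed.

Let fps_mul1 : left_id (fpsC 1) fps_mul.
Proof.
move=> a; apply: fpsP => n /=; rewrite big_ord_recl /= mul1r subn0.
by rewrite big1 ?addr0 // => i _; rewrite mul0r.
Qed.

Let fps_mulDl : left_distributive fps_mul fps_add.
Proof.
move=> a b c; apply: fpsP => n /=; rewrite -big_split /=.
by apply: eq_bigr => i _; rewrite mulrDl.
Qed.

Let fps_oner_neq0 : fpsC 1 != 0.
Proof.
by apply/eqP => /(congr1 (fun a => fps_coef a 0)) /= /eqP; rewrite oner_eq0.
Qed.

HB.instance Definition _ := GRing.Zmodule_isComNzRing.Build (fps R)
  fps_mulA fps_mulC fps_mul1 fps_mulDl fps_oner_neq0.

End FpsRing.

(** * Rooted trees *)

(* A rooted tree on the vertex set V is encoded by its root [p.1] and its parent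
   map [p.2]: the edge going out of w is w -> v when [p.2 w = Some v], and the
   root is the only vertex without an outgoing edge. *)
Definition is_rtree (V : finType) (p : V * {ffun V -> option V}) : bool :=
  [forall v, (p.2 v == None) == (v == p.1)]
  && [forall v, connect [rel x y | p.2 x == Some y] v p.1].

Record rtree (V : finType) := RTree {
  rtree_val : V * {ffun V -> option V};
  rtree_valP : is_rtree rtree_val }.

HB.instance Definition _ (V : finType) := [isSub for @rtree_val V].
HB.instance Definition _ (V : finType) := [Finite of rtree V by <:].

Definition root (V : finType) (T : rtree V) : V := (rtree_val T).1.
Definition par (V : finType) (T : rtree V) : {ffun V -> option V} :=
  (rtree_val T).2.
Definition child (V : finType) (T : rtree V) (w v : V) : bool :=
  par T w == Some v.

Lemma par_eq0 (V : finType) (T : rtree V) v :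
  (par T v == None) = (v == root T).
Proof. by case/andP: (rtree_valP T) => /forallP /(_ v) /eqP. Qed.

Lemma connect_root (V : finType) (T : rtree V) v : connect (child T) v (root T).
Proof. by case/andP: (rtree_valP T) => _ /forallP /(_ v). Qed.

(* Commuting with the parent maps includes sending the root to the root. *)
Definition isom (V W : finType) (T : rtree V) (U : rtree W) : Prop :=
  exists2 f : V -> W, bijective f & forall v, par U (f v) = omap f (par T v).

Definition aut (V : finType) (T : rtree V) : nat :=
  #|[pred s : {perm V} | [forall v, par T (s v) == omap s (par T v)]]|.

Lemma isom_refl (V : finType) (T : rtree V) : isom T T.
Proof. by exists id => [|v]; [exists id | case: (par T v)]. Qed.

Lemma isom_sym (V W : finType) (T : rtree V) (U : rtree W) :
  isom T U -> isom U T.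
Proof.
case=> f [g fK gK] fP; exists g => [|w]; first by exists f.
by rewrite -{2}(gK w) fP; case: (par T (g w)) => //= v; rewrite fK.
Qed.

Lemma isom_trans (V W X : finType) (T : rtree V) (U : rtree W) (Z : rtree X) :
  isom T U -> isom U Z -> isom T Z.
Proof.
case=> f bf fP [g bg gP]; exists (g \o f) => [|v]; first exact: bij_comp.
by rewrite /= gP fP; case: (par T v).
Qed.

(** * Isomorphism classes of rooted trees *)

Definition otree := {n : nat & rtree 'I_n}.

Definition otree_eqv : rel otree := fun T U => `[< isom (tagged T) (tagged U) >].

Lemma otree_eqv_refl : reflexive otree_eqv.
Proof. by move=> T; apply/asboolP; exact: isom_refl. Qed.

Lemma otree_eqv_sym : symmetric otree_eqv.
Proof. by move=> T U; apply/asboolP/asboolP; exact: isom_sym. Qed.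

Lemma otree_eqv_trans : transitive otree_eqv.
Proof.
by move=> U T Z /asboolP TU /asboolP UZ; apply/asboolP; exact: isom_trans TU UZ.
Qed.

Canonical otree_equiv :=
  EquivRel otree_eqv otree_eqv_refl otree_eqv_sym otree_eqv_trans.

Definition isotree := {eq_quot otree_equiv}.
HB.instance Definition _ := Choice.on isotree.
HB.instance Definition _ := EqQuotient.on isotree.

Definition nverts (T : isotree) : nat := tag (repr T).
Definition rep (T : isotree) : rtree 'I_(nverts T) := tagged (repr T).

Lemma finite_nverts (n : nat) : finite_set [set T | nverts T <= n]%N%classic.
Proof.
pose F (U : {k : 'I_n.+1 & rtree 'I_k}) : isotree :=
  \pi_isotree (Tagged (fun k => rtree 'I_k) (tagged U) : otree).
apply: (@sub_finite_set _ _ [set F U | U in setT]%classic); last first.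
  exact/finite_image/finite_finset.
rewrite /nverts => T /=; rewrite -{2}[T]reprK.
case: (repr T) => k U /=; rewrite -ltnS => lt_kn.
by exists (Tagged (fun j : 'I_n.+1 => rtree 'I_j)
                  (U : rtree 'I_(Ordinal lt_kn))).
Qed.

(** * The operation S(T_1, ..., T_m) and the diamond product *)

Section Graft.
Variables (V : finType) (S : rtree V).
Variables (W : V -> finType) (T : forall i, rtree (W i)).

(* [c i = Some (j, y)] chooses, for the edge i -> j of S, the vertex y of T_j;
   [c] is [None] at the root of S, which has no outgoing edge. *)
Definition graft_choice :=
  {c : {ffun V -> option {j : V & W j}}
     | [forall i, omap tag (c i) == par S i]}.

Definition graft_val (c : graft_choice) :
    {i : V & W i} * {ffun {i : V & W i} -> option {i : V & W i}} :=
  (Tagged W (root (T (root S))),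
   [ffun x => if par (T (tag x)) (tagged x) is Some y then Some (Tagged W y)
              else val c (tag x)]).

Lemma graft_subproof (c : graft_choice) : is_rtree (graft_val c).
Proof.
have cP i : omap tag (val c i) = par S i.
  by apply/eqP; move/forallP: (valP c) => /(_ i).
pose e : rel {i : V & W i} := [rel x y | (graft_val c).2 x == Some y].
have eT i (x : W i) : connect e (Tagged W x) (Tagged W (root (T i))).
  have /connectP[p xp ->] := connect_root (T i) x.
  elim: p x xp => [|y p IHp] x /=; first by rewrite connect0.
  case/andP=> /eqP xy /IHp; apply: connect_trans.
  by apply: connect1; rewrite /e /= ffunE /= xy.
have eS i : connect e (Tagged W (root (T i))) (graft_val c).1.
  have /connectP[p ip def_r] := connect_root S i.
  rewrite /= def_r; elim: p i ip {def_r} => [|j p IHp] i /=.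
    by rewrite connect0.
  case/andP=> /eqP ij /IHp; apply: connect_trans.
  have := cP i; rewrite ij; case Dc: (val c i) => [[k y]|] //= [Dk].
  move: y Dc; rewrite Dk => y Dc; apply: connect_trans (eT j y).
  apply: connect1; rewrite /e /= ffunE /=.
  have /eqP -> : par (T i) (root (T i)) == None by rewrite par_eq0.
  by rewrite /= Dc.
apply/andP; split; apply/forallP; last first.
  by case=> i x; apply: connect_trans (eT i x) (eS i).
case=> i x; rewrite ffunE.
have -> : (Tagged W x == (graft_val c).1) = (i == root S) && (x == root (T i)).
  rewrite /graft_val /=; have [<-|nei] := eqVneq i (root S).
    by rewrite eq_Tagged.
  by apply/eqP => /(congr1 tag) /= /eqP; rewrite (negPf nei).
rewrite -!par_eq0 /= -(cP i); case: (par (T i) x) => [y|]; rewrite ?andbF //.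
by case: (val c i) => [[]|].
Qed.

Definition graft (c : graft_choice) : rtree {i : V & W i} :=
  RTree (graft_subproof c).

End Graft.

(* A series sum_T a_T T is the map T |-> a_T; the weights 1/aut(T) are thus part
   of the coefficients. *)
Definition tseries (R : Type) := isotree -> R.

Section Diamond.
Variable R : comNzRingType.

(* Coefficient of T in the finite sum of trees S(T_1, ..., T_m). *)
Definition insertion_coef (V : finType) (S : rtree V) (Ts : V -> isotree)
    (T : isotree) : nat :=
  #|[pred c : graft_choice S (fun i => 'I_(nverts (Ts i)))
      | `[< isom (graft (fun i => rep (Ts i)) c) (rep T) >]]|.

Lemma insertion_coef_nverts (V : finType) (S : rtree V) (Ts : V -> isotree) T :
  insertion_coef S Ts T != 0%N -> nverts T = (\sum_i nverts (Ts i))%N.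
Proof.
rewrite -lt0n => /card_gt0P[c /asboolP[f bf _]].
rewrite -[LHS]card_ord -(bij_eq_card bf) card_tagged sumnE big_map big_enum /=.
by apply: eq_bigr => i _; rewrite card_ord.
Qed.

Lemma insertion_finite (V : finType) (S : rtree V) T :
  finite_set [set Ts : {ffun V -> isotree} | insertion_coef S Ts T != 0%N]%classic.
Proof.
have /finite_seqP[s def_s] := finite_nverts (nverts T).
pose F (g : {ffun V -> seq_sub s}) := [ffun i => val (g i)].
apply: (@sub_finite_set _ _ [set F g | g in setT]%classic); last first.
  exact/finite_image/finite_finset.
move=> Ts /= /insertion_coef_nverts nT.
have sTs i : Ts i \in s.
  have : [set T' | nverts T' <= nverts T]%N%classic (Ts i).
    by rewrite /= nT (bigD1 i) //= leq_addr.
  by rewrite def_s.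
by exists [ffun i => SeqSub (sTs i)] => //; apply/ffunP => i; rewrite !ffunE.
Qed.

(* Multilinear extension of S(T_1, ..., T_m) to series; the sum over the families
   of trees has finite support by [insertion_finite]. *)
Definition insertion (V : finType) (S : rtree V) (ts : V -> tseries R) :
    tseries R := fun T =>
  \sum_(Ts \in [set: {ffun V -> isotree}]%classic)
    (\prod_i ts i (Ts i)) * (insertion_coef S Ts T)%:R.

Lemma insertion0 (V : finType) (S : rtree V) (ts : V -> tseries R) T :
  (nverts T < #|V|)%N -> insertion S ts T = 0.
Proof.
move=> ltTV; apply: fsbig1 => Ts _.
have [-> | nz] := eqVneq (insertion_coef S Ts T) 0%N; first by rewrite mulr0.
suff /leq_gtF : (#|V| <= nverts T)%N by rewrite ltTV.
rewrite (insertion_coef_nverts nz) -sum1_card.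
apply: leq_sum => i _.
exact: leq_ltn_trans (leq0n _) (ltn_ord (root (rep (Ts i)))).
Qed.

(* The sum has finite support by [insertion0] and [finite_nverts]. *)
Definition diamond (s t u : tseries R) : tseries R := fun T =>
  \sum_(S \in [set: isotree]%classic)
    s S * insertion (rep S) (fun i => if i == root (rep S) then t else u) T.

End Diamond.

(** * Flows *)

Section Flows.
Variables (V : finType) (T : rtree V).

(* [f.1] is the set of outputs and [f.2] the multiplicity of inputs. *)
Definition preflow := ({set V} * {ffun V -> nat})%type.

Definition is_rate (f : preflow) (r : V -> int) : Prop :=
  forall v, r v = (f.2 v)%:Z - (v \in f.1)%:Z + \sum_(w | child T w v) r w.

Definition is_flow (f : preflow) (r : V -> int) : Prop :=
  [/\ forall v, v \in f.1 -> f.2 v = 0%N, is_rate f r & forall v, 0 <= r v].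

Definition is_cflow (f : preflow) (r : V -> int) : Prop :=
  is_flow f r /\ forall v, v != root T -> 1 <= r v.

Definition flows (n : nat) : set preflow :=
  [set f | exists2 r, is_flow f r & r (root T) = n%:Z]%classic.

Definition cflows (n : nat) : set preflow :=
  [set f | exists2 r, is_cflow f r & r (root T) = n%:Z]%classic.

Lemma sum_rate (f : preflow) (r : V -> int) : is_rate f r ->
  r (root T) = (\sum_v f.2 v)%N%:Z - #|f.1|%:Z.
Proof.
move=> fr; have: \sum_v r v = \sum_v r v by [].
rewrite {1}(bigD1 (root T)) //= [in RHS](eq_bigr _ (fun v _ => fr v)).
rewrite big_split sumrB /= (exchange_big_dep predT) //=.
have -> : \sum_w \sum_(v | child T w v) r w = \sum_(w | w != root T) r w.
  rewrite [RHS]big_mkcond; apply: eq_bigr => w _; rewrite -par_eq0 /child.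
  case: (par T w) => [v|] /=; last by rewrite big_pred0.
  by rewrite (big_pred1 v) // => u; rewrite /= eq_sym.
move/addIr => ->; congr (_ - _).
  by rewrite -natz natr_sum; under [RHS]eq_bigr do rewrite natz.
rewrite -sum1_card -natz natr_sum [RHS]big_mkcond /=.
by apply: eq_bigr => v _; case: (v \in f.1).
Qed.

Lemma flows_finite (n : nat) : finite_set (flows n).
Proof.
pose F (g : {set V} * {ffun V -> 'I_(n + #|V|).+1}) : preflow :=
  (g.1, [ffun v => val (g.2 v)]).
apply: (@sub_finite_set _ _ [set F g | g in setT]%classic); last first.
  exact/finite_image/finite_finset.
move=> [O m] [r [_ fr _] rn]; exists (O, [ffun v => inord (m v)]) => //.
congr (_, _); apply/ffunP => v; rewrite !ffunE /= inordK // ltnS.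
move: (sum_rate fr); rewrite rn /= => /eqP; rewrite eq_sym subr_eq -PoszD.
move=> /eqP[sm]; apply: (@leq_trans (\sum_v m v)).
  by rewrite (bigD1 v) //= leq_addr.
by rewrite sm leq_add2l max_card.
Qed.

Lemma cflows_finite (n : nat) : finite_set (cflows n).
Proof.
by apply: sub_finite_set (flows_finite n) => f [r [fr _] rn]; exists r.
Qed.

(* Elements of Q[b][[t]], where b is ['X]. *)
Definition flow_gen : fps {poly rat} :=
  Fps (fun n => \sum_(f \in flows n) ('X^#|f.1| : {poly rat})).

Definition cflow_gen : fps {poly rat} :=
  Fps (fun n => \sum_(f \in cflows n) ('X^#|f.1| : {poly rat})).

End Flows.

Definition inv_aut (T : isotree) : fps {poly rat} :=
  fpsC ((aut (rep T))%:R^-1)%:P.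

Definition tree_series : tseries (fps {poly rat}) := inv_aut.

Definition flow_series : tseries (fps {poly rat}) :=
  fun T => flow_gen (rep T) * inv_aut T.

Definition cflow_series : tseries (fps {poly rat}) :=
  fun T => cflow_gen (rep T) * inv_aut T.

(* Value at t = 0, again seen as a series over Q[b][[t]]. *)
Definition cflow_series0 : tseries (fps {poly rat}) :=
  fun T => fpsC (fps_coef (cflow_series T) 0).

(* Main.v *)
Require Import Defs.
From mathcomp Require Import all_boot all_order all_algebra.
From mathcomp Require Import all_classical.
From mathcomp Require Import perm.
(* After the polynomial library, [root] must again mean the root of a tree. *)
Import Defs.

(** Given a flow on [T], let [A] consist of the root and of the vertices whose
outgoing edge has rate zero, and cut the edges going out of [A].  The pieces
carry connected flows, with exit rate zero except for the piece of the root, and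
[T] is recovered by grafting the pieces along the quotient tree whose vertices
are the elements of [A].  The theorem is this bijection, and the work lies in
the automorphism factors.

Those are handled by counting isomorphisms instead of isomorphism classes.
Multiplied by [aut T], the number of choices [c] for which the graft of
[(T_i)_i] along [S] is isomorphic to [T] becomes the number of pairs of a choice
[c] and an isomorphism from [graft c] to [T].  Such an isomorphism sends the
roots of the [T_i] to a set [A] of vertices of [T].

- The product of the connected flow series of the [T_i] is the series of flows
  on [graft c] cut exactly at the roots of the [T_i] ([cut_gen_graft]), hence
  the series [cut_gen T A] of flows on [T] cut at [A] ([cut_gen_iso]); so it
  depends on [A] alone.
- For fixed [A], a pair of [c] and an isomorphism amounts to an isomorphism [s]
  from [S] to the quotient of [T] by [A], together with, for each [i], an
  isomorphism from [T_i] to the component of [s i] ([card_graft_isos]).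
- For a fixed tree [X], the sum over isomorphism classes [U] of the number of
  isomorphisms from [U] to [X], divided by [aut U], is [1]: only the class of
  [X] contributes ([sum_embs]).  Applied to every component and then to the
  quotient, this shows that every [A] has total weight [1].

What remains is the sum of [cut_gen T A] over all [A] containing the root, which
is the series of all flows on [T] ([flow_gen_cut]). *)

Set Implicit Arguments.
Unset Strict Implicit.
Unset Printing Implicit Defensive.

Import GRing.Theory Num.Theory.
Local Open Scope ring_scope.
Local Open Scope quotient_scope.
Local Open Scope set_scope.

(** * Power series *)

Section PowerSeries.
Variable R : comNzRingType.
Implicit Types a : fps R.

Lemma fps_coef0 n : fps_coef (0 : fps R) n = 0.
Proof. by case: n. Qed.

Lemma fpsC_mul (x y : R) : fpsC (x * y) = fpsC x * fpsC y.
Proof.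
apply: fpsP => -[|n] /=; first by rewrite big_ord_recl big_ord0 addr0.
rewrite big1 // => i _.
by case: i => -[|i] //= _; rewrite ?mulr0 ?mul0r.
Qed.

Lemma fpsC_nat n : fpsC (n%:R : R) = n%:R.
Proof.
elim: n => [|n IHn]; first by [].
rewrite -!natr1 -IHn; apply: fpsP => -[|m] //=; by rewrite addr0.
Qed.

Lemma fps_coef_sum (I : Type) (r : seq I) (P : pred I) (F : I -> fps R) n :
  fps_coef (\sum_(i <- r | P i) F i) n = \sum_(i <- r | P i) fps_coef (F i) n.
Proof.
by apply: (big_morph (fun a => fps_coef a n)) => [a b|]; rewrite ?fps_coef0.
Qed.

Lemma fps_coefMC a x n : fps_coef (a * fpsC x) n = fps_coef a n * x.
Proof.
rewrite {1}/GRing.mul /= big_ord_recr /= subnn big1 ?add0r // => i _.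
by have := ltn_ord i; rewrite -subn_gt0; case: (n - i)%N => // k; rewrite mulr0.
Qed.

Lemma fpsC_prod (I : Type) (r : seq I) (P : pred I) (F : I -> R) :
  fpsC (\prod_(i <- r | P i) F i) = \prod_(i <- r | P i) fpsC (F i).
Proof. by apply: (big_morph _ fpsC_mul). Qed.

Lemma fps_coef_prod_at (I : finType) (i0 : I) (a : I -> fps R) n :
  fps_coef (\prod_i (if i == i0 then a i else fpsC (fps_coef (a i) 0))) n
    = \prod_i fps_coef (a i) (if i == i0 then n else 0%N).
Proof.
rewrite (bigD1 i0) // [RHS](bigD1 i0) // eqxx.
have -> : \prod_(i | i != i0) (if i == i0 then a i else fpsC (fps_coef (a i) 0))
          = fpsC (\prod_(i | i != i0) fps_coef (a i) 0).
  by rewrite fpsC_prod; apply: eq_bigr => i /negPf ->.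
by rewrite fps_coefMC; congr (_ * _); apply: eq_bigr => i /negPf ->.
Qed.

End PowerSeries.

(** * Finite sums *)

Definition slice (I : finType) (W : I -> finType) (D : Type)
    (f : {ffun {i : I & W i} -> D}) (i : I) : {ffun W i -> D} :=
  [ffun x => f (Tagged W x)].

(** A function on a disjoint union is a family of functions, so this is the
expansion of a product of sums, for factors indexed by different types. *)
Lemma sum_prod_curry (R : comNzRingType) (I : finType) (W : I -> finType)
    (D : finType) (F : forall i, {ffun W i -> D} -> R) :
  \sum_(f : {ffun {i : I & W i} -> D}) \prod_i F i (slice f i)
    = \prod_i \sum_(g : {ffun W i -> D}) F i g.
Proof.
pose X i : finType := {ffun W i -> D}; pose G i := [ffun g : X i => F i g].
transitivity (\sum_(t : fprod X) \prod_(i in I) G i (t i)); last first.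
  rewrite big_fprod -(bigA_distr_big_dep _ (fun i g => untag 0 (G i) g)).
  apply: eq_bigr => i _; rewrite -(big_tag (fun i => G i)).
  by apply: eq_bigr => g _; rewrite ffunE.
pose cur (f : {ffun {i : I & W i} -> D}) : fprod X :=
  fprod_of_fun (fun i => slice f i : X i).
pose unc (t : fprod X) := [ffun x : {i : I & W i} => t (tag x) (tagged x)].
rewrite (reindex cur) /=; last first.
  apply: onW_bij; exists unc => [f | t].
    by apply/ffunP => -[i x]; rewrite ffunE fprodE ffunE.
  by apply/fprodP => i; rewrite fprodE; apply/ffunP => x; rewrite !ffunE.
by apply: eq_bigr => f _; apply: eq_bigr => i _; rewrite fprodE ffunE.
Qed.

Lemma fsum_range (R : nmodType) (X : choiceType) (J : finType) (g : J -> X)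
    (F : X -> R) : injective g -> (forall x, F x != 0 -> exists j, x = g j) ->
  \sum_(x \in [set: X]%classic) F x = \sum_j F (g j).
Proof.
move=> g_inj Fg.
rewrite (@fsbigE _ _ _ _ _ (codom g)) //; first 1 last.
- exact/injectiveP.
- by move=> x _; apply: contraNeq => /Fg[j ->]; exact: codom_f.
by rewrite big_image_cond; apply: eq_bigl => j; rewrite in_setT.
Qed.

(** * Induction along a rooted tree *)

Section TreeInduction.
Variables (V : finType) (T : rtree V).

Lemma par_root : par T (root T) = None.
Proof. by apply/eqP; rewrite par_eq0. Qed.

Lemma par_None v : par T v = None -> v = root T.
Proof. by move/eqP; rewrite par_eq0 => /eqP. Qed.

Lemma rtree_ind (P : V -> Prop) :
  (forall v, (forall u, par T v = Some u -> P u) -> P v) -> forall v, P v.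
Proof.
move=> IP v; have /connectP[p vp] := connect_root T v.
elim: p v vp => [|u p IHp] v /=.
  by move=> _ <-; apply: IP => u; rewrite par_root.
case/andP=> /eqP vu pu eq_r; apply: IP => u'; rewrite vu => -[<-]; exact: IHp.
Qed.

(** A cycle through [v] passes through its parent [u], which would then lie on a
cycle as well; so the absence of cycles descends from the root. *)
Lemma par_acyclic v u : par T v = Some u -> ~~ connect (child T) u v.
Proof.
elim/rtree_ind: v u => v IHv u vu; apply/negP => /connectP[[|w p]] /=.
  move=> _ eq_uv; subst u; have /negP[] := IHv v vu v vu; exact: connect0.
case/andP=> uw wp Dv; have /negP[] := IHv u vu w (eqP uw).
apply: (@connect_trans _ _ v); last by apply: connect1; rewrite /child vu.
by apply/connectP; exists p.
Qed.

(** Well-founded because, by acyclicity, a child has strictly fewer descendants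
than its parent. *)
Lemma rtree_ind_up (P : V -> Prop) :
  (forall v, (forall w, par T w = Some v -> P w) -> P v) -> forall v, P v.
Proof.
move=> IP v; pose des v := [set u | connect (child T) u v].
have [n] := ubnP #|des v|; elim: n v => // n IHn v le_n.
apply: IP => w wv; apply: IHn; apply: leq_trans (_ : #|des v| <= n)%N => //.
have wv1 : connect (child T) w v by apply: connect1; rewrite /child wv.
apply/proper_card/properP; split.
  by apply/fintype.subsetP => u; rewrite !inE => /connect_trans; apply.
by exists v; rewrite !inE ?connect0 // (negPf (par_acyclic wv)).
Qed.

End TreeInduction.

(** * Embeddings of trees and automorphisms *)

(** The isomorphisms from [U] to the tree with vertices [B] and parent map [p],
with values in the ambient type [V].  Subtrees and quotients of a tree on [V]
are thus described by a pair [(p, B)], without a type for their vertices;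
[p] may be arbitrary outside [B]. *)
Definition embs (W V : finType) (U : rtree W) (p : V -> option V)
    (B : {set V}) : {set {ffun W -> V}} :=
  [set f : {ffun W -> V} | [&& injectiveb f, f @: [set: W] == B
                    & [forall x, p (f x) == omap f (par U x)]]].

Lemma embsP (W V : finType) (U : rtree W) p (B : {set V}) (f : {ffun W -> V}) :
  reflect [/\ injective f, f @: [set: W] = B
            & forall x, p (f x) = omap f (par U x)] (f \in embs U p B).
Proof.
rewrite inE; apply: (iffP and3P) => [[/injectiveP ? /eqP ? /forallP fP] | []].
  by split=> // x; apply/eqP.
move=> f_inj -> fP; split=> //; first exact/injectiveP.
by apply/forallP => x; rewrite fP.
Qed.

Lemma isosP (W V : finType) (U : rtree W) (T : rtree V) (f : {ffun W -> V}) :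
  reflect (bijective f /\ forall x, par T (f x) = omap f (par U x))
          (f \in embs U (par T) [set: V]).
Proof.
apply: (iffP (embsP _ _ _ _)) => [[f_inj im_f fP] | [f_bij fP]]; split=> //.
- have/fintype.fin_all_exists[g gP] v : exists x, v = f x.
    have /imsetP[x _ ->] : v \in f @: [set: W] by rewrite im_f inE.
    by exists x.
  by exists g => x; [apply: f_inj|]; rewrite -gP.
- exact: bij_inj.
apply/setP => v; rewrite inE; apply/imsetP; case: f_bij => g _ gK.
by exists (g v); rewrite ?inE ?gK.
Qed.

Lemma isomP (W V : finType) (U : rtree W) (T : rtree V) :
  isom U T <-> exists f, f \in embs U (par T) [set: V].
Proof.
split=> [[f bf fP] | [f /isosP[bf fP]]]; last by exists f.
exists (finfun f); apply/isosP; split.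
  case: bf => g fK gK; exists g => x; last by rewrite ffunE gK.
  by rewrite ffunE fK.
by move=> x; rewrite ffunE fP; case: (par U x) => //= y; rewrite ffunE.
Qed.

(** Composing one isomorphism with all automorphisms of the target gives all of
them. *)
Lemma card_isos (W V : finType) (U : rtree W) (T : rtree V) :
  #|embs U (par T) [set: V]| = if `[< isom U T >] then aut T else 0%N.
Proof.
case: asboolP => [/isomP[f f_iso] | no_iso]; last first.
  apply: eq_card0 => f; apply/negP => fP; apply: no_iso.
  by apply/isomP; exists f.
have /isosP[[g fK gK] fP] := f_iso.
pose h (s : {perm V}) := [ffun x => s (f x)] : {ffun W -> V}.
have h_inj : injective h.
  move=> s1 s2 /ffunP eq_h; apply/permP => v.
  by have := eq_h (g v); rewrite !ffunE gK.
rewrite /aut -(fintype.card_image h_inj); apply: eq_card => f'.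
apply/idP/fintype.imageP => [/isosP[[g' f'K g'K] f'P] | [s sP ->]].
  have s_inj : injective (fun v => f' (g v)).
    exact: inj_comp (can_inj f'K) (can_inj gK).
  exists (perm s_inj); last by apply/ffunP => x; rewrite ffunE permE fK.
  rewrite inE; apply/forallP => v; rewrite permE f'P; apply/eqP.
  rewrite -[in RHS](gK v) fP; case: (par U _) => //= x.
  by rewrite permE fK.
move: sP; rewrite inE => /forallP sP; apply/isosP; split.
  exists (g \o perm_inv s) => x; rewrite /= ffunE ?gK ?permKV //.
  by rewrite permK fK.
move=> x; rewrite ffunE (eqP (sP _)) fP; case: (par U x) => //= y.
by rewrite ffunE.
Qed.

(** Every embedding onto [B] factors through a given one. *)
Lemma card_embs (W W' V : finType) (U : rtree W) (U' : rtree W')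
    (p : V -> option V) B (f : {ffun W' -> V}) :
  f \in embs U' p B -> #|embs U p B| = #|embs U (par U') [set: W']|.
Proof.
move=> /embsP[f_inj im_f fP].
pose h (g : {ffun W -> W'}) := [ffun x => f (g x)] : {ffun W -> V}.
have h_inj : injective h.
  move=> g1 g2 /ffunP eq_h; apply/ffunP => x; apply: f_inj.
  by have := eq_h x; rewrite !ffunE.
rewrite -(fintype.card_image h_inj); apply: eq_card => f'.
apply/embsP/fintype.imageP => [[f'_inj im_f' f'P] | [g gP ->]].
  have /fintype.fin_all_exists[g gP] x : exists y, f' x = f y.
    have: f' x \in f @: [set: _] by rewrite im_f -im_f' imset_f.
    by case/imsetP=> y _ ->; exists y.
  exists (finfun g); last by apply/ffunP => x; rewrite !ffunE.
  apply/embsP; split=> [x y | | x]; rewrite ?ffunE.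
  - by move/(congr1 f); rewrite -!gP => /f'_inj.
  - apply/setP => y; rewrite inE; apply/imsetP.
    have: f y \in f' @: [set: _] by rewrite im_f' -im_f imset_f.
    by case/imsetP=> x _; rewrite gP => /f_inj ->; exists x; rewrite ?ffunE.
  have := f'P x; rewrite gP fP.
  case: (par U' _) (par U x) => [y|] [z|] //= []; rewrite ?gP ffunE.
  by move/f_inj ->.
have /embsP[g_inj im_g gE] := gP; split=> [x y | | x]; rewrite ?ffunE.
- by move/f_inj/g_inj.
- by rewrite -im_f -im_g -imset_comp; apply: eq_imset => x; rewrite !ffunE.
by rewrite fP gE; case: (par U x) => //= y; rewrite ffunE.
Qed.

(** These conditions are what it takes for some rooted tree to embed onto [B]:
see [tree_on_rep]. *)
Definition tree_on (V : finType) (p : V -> option V) (B : {set V}) (k : V) :=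
  [/\ k \in B,
      forall v, v \in B -> (p v == None) = (v == k),
      forall v u, v \in B -> p v = Some u -> u \in B
    & forall v, v \in B -> connect [rel x y | p x == Some y] v k].

Lemma isotree_eq (U U' : isotree) : isom (rep U) (rep U') -> U = U'.
Proof.
by move=> UU'; rewrite -[U]reprK -[U']reprK; apply/eqmodP/asboolP.
Qed.

Definition isoclass n (U : rtree 'I_n) : isotree :=
  \pi_isotree (Tagged (fun n => rtree 'I_n) U : otree).

Lemma rep_isoclass n (U : rtree 'I_n) : isom (rep (isoclass U)) U.
Proof. by have /eqmodP/asboolP := reprK (isoclass U). Qed.

(** Numbering the vertices of [B] yields a tree on an ordinal, whose class is
the class sought. *)
Lemma tree_on_rep (V : finType) (p : V -> option V) B k : tree_on p B k ->
  exists U : isotree, exists f, f \in embs (rep U) p B.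
Proof.
move=> [kB pN pB pk].
pose e : 'I_#|B| -> V := enum_val; pose r : V -> 'I_#|B| := enum_rank_in kB.
have eB x : e x \in B := enum_valP x.
have rK v : v \in B -> e (r v) = v by exact: enum_rankK_in.
have eK x : r (e x) = x by exact: enum_valK_in.
pose q := [ffun x : 'I_#|B| => omap r (p (e x))].
have qP : is_rtree (r k, q).
  apply/andP; split; apply/forallP => x /=.
    rewrite ffunE -(inj_eq (can_inj eK)) rK // -pN //.
    by case: (p (e x)).
  rewrite -[x]eK; have /connectP[s] := pk _ (eB x).
  move: (eB x); move: (e x) => v; elim: s v => [|u s IHs] v vB /=.
    by move=> _ ->; rewrite connect0.
  case/andP=> /eqP vu us Dk; apply: connect_trans (IHs _ (pB _ _ vB vu) us Dk).
  by apply: connect1; rewrite /= ffunE rK // vu.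
pose U := RTree qP; exists (isoclass U).
have /isomP[g /isosP[[g' gK g'K] gP]] := rep_isoclass U.
exists [ffun x => e (g x)]; apply/embsP; split=> [x y | | x]; rewrite ?ffunE.
- by move/enum_val_inj/(can_inj gK).
- apply/setP => v; apply/imsetP/idP => [[x _ ->] | vB]; first by rewrite ffunE.
  by exists (g' (r v)); rewrite ?inE // ffunE g'K rK.
have := gP x; rewrite /par /= ffunE -/(par _ _) => /(congr1 (omap e)).
have -> : omap e (omap r (p (e (g x)))) = p (e (g x)).
  by case Dp: (p _) => [u|] //=; rewrite rK // (pB _ _ (eB _) Dp).
by move=> ->; case: (par _ x) => //= y; rewrite ffunE.
Qed.

Lemma card_embs_rep (V : finType) (p : V -> option V) B (U : isotree) f :
  f \in embs (rep U) p B -> nverts U = #|B|.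
Proof. by case/embsP=> f_inj <- _; rewrite card_imset // cardsT card_ord. Qed.

Lemma aut_gt0 (V : finType) (T : rtree V) : (0 < aut T)%N.
Proof.
apply/card_gt0P; exists 1%g; rewrite inE; apply/forallP => v.
by rewrite perm1; case: (par T v) => //= u; rewrite perm1.
Qed.

Lemma inv_autK (T : isotree) : inv_aut T * (aut (rep T))%:R = 1.
Proof.
rewrite -fpsC_nat -fpsC_mul -polyC_natr -polyCM mulVf //.
by rewrite pnatr_eq0 -lt0n aut_gt0.
Qed.

(** The groupoid cardinality of the trees over a fixed tree is one.  The family
[g] enumerates finitely many classes, among them every class with at most [#|B|]
vertices; all others have no embedding onto [B]. *)
Lemma sum_embs (J : finType) (g : J -> isotree) (V : finType)
    (p : V -> option V) (B : {set V}) (k : V) : injective g ->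
  (forall U, (nverts U <= #|B|)%N -> exists j, U = g j) -> tree_on p B k ->
  \sum_j inv_aut (g j) * #|embs (rep (g j)) p B|%:R = 1.
Proof.
move=> g_inj g_sur /tree_on_rep[U [f fP]].
have [|j Dj] := g_sur U; first by rewrite (card_embs_rep fP).
rewrite (bigD1 j) //= big1 ?addr0 => [|i ne_ij].
  rewrite -Dj (card_embs _ fP) card_isos asboolT ?inv_autK //.
  exact: isom_refl.
rewrite (card_embs _ fP) card_isos; case: asboolP; rewrite ?mulr0 //.
by move/isotree_eq; rewrite Dj => /g_inj Di; rewrite Di eqxx in ne_ij.
Qed.

(** * Cutting a tree into a quotient and components *)

Section Cut.
Variables (V : finType) (T : rtree V) (A : {set V}).
Hypothesis rootA : root T \in A.

Definition uncut_edge : rel V := fun x y => (x \notin A) && child T x y.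

(** The root of the component of [v] after the edges going out of [A] have been
cut: the first element of [A] on the way from [v] to the root of [T].  A path
of [uncut_edge] stops as soon as it enters [A]. *)
Definition cut_top (v : V) : V :=
  odflt v [pick a in A | connect uncut_edge v a].

Lemma connect_uncut v u a : v \notin A -> par T v = Some u -> a \in A ->
  connect uncut_edge v a = connect uncut_edge u a.
Proof.
move=> vA vu aA; have uncut_v w : uncut_edge v w = (w == u).
  by rewrite /uncut_edge vA /child vu; apply/eqP/eqP => [[->] | ->].
apply/connectP/idP => [[[|w p] /=] | /connectP[p up ->]].
- by move=> _ Da; rewrite -Da aA in vA.
- by rewrite uncut_v => /andP[/eqP -> up] ->; apply/connectP; exists p.
by exists (u :: p); rewrite //= uncut_v eqxx.
Qed.

Lemma cut_topP v : cut_top v \in A /\ connect uncut_edge v (cut_top v).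
Proof.
rewrite /cut_top; case: pickP => [a /andP[] // | no_a] /=; exfalso.
elim/(rtree_ind (T := T)): v no_a => v IHv no_a.
have vA : v \notin A by have := no_a v; rewrite connect0 andbT => ->.
case vu: (par T v) => [u|]; last by rewrite (par_None vu) rootA in vA.
apply: (IHv u vu) => a; rewrite -[RHS](no_a a).
by have [aA|//] := boolP (a \in A); rewrite (connect_uncut vA vu).
Qed.

Lemma cut_top_in v : cut_top v \in A.
Proof. by case: (cut_topP v). Qed.

Lemma cut_top_id v : v \in A -> cut_top v = v.
Proof.
have [_ /connectP[[|u p] /= vp Dv vA //]] := cut_topP v.
by move: vp; rewrite /uncut_edge vA.
Qed.

Lemma cut_top_par v u : v \notin A -> par T v = Some u -> cut_top v = cut_top u.
Proof.
move=> vA vu; rewrite /cut_top.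
have -> : [pick a in A | connect uncut_edge v a]
          = [pick a in A | connect uncut_edge u a].
  apply: eq_pick => a /=.
  by have [aA|//] := boolP (a \in A); rewrite (connect_uncut vA vu).
case: pickP => //= no_a.
by have [tA tc] := cut_topP u; have := no_a (cut_top u); rewrite tA tc.
Qed.

(** Parent map, on [A], of the quotient of [T] by its components. *)
Definition quot_par (v : V) : option V := omap cut_top (par T v).

(** Parent map, on [cut_comp k], of the component rooted at [k]. *)
Definition comp_par (k v : V) : option V := if v == k then None else par T v.

Definition cut_comp (k : V) : {set V} := [set v | cut_top v == k].

Lemma tree_on_quot : tree_on quot_par A (root T).
Proof.
split=> // [v vA | v u _ | v vA].
- by rewrite /quot_par -par_eq0; case: (par T v).
- by rewrite /quot_par; case: (par T v) => //= w [<-]; apply: cut_top_in.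
rewrite -{1}(cut_top_id vA) {vA}; elim/(rtree_ind (T := T)): v => v IHv.
have [vA | vA] := boolP (v \in A); last first.
  case vu: (par T v) => [u|]; last by rewrite (par_None vu) rootA in vA.
  by rewrite (cut_top_par vA vu); apply: IHv.
rewrite cut_top_id //; case vu: (par T v) => [u|]; last first.
  by rewrite (par_None vu) connect0.
by apply: connect_trans (IHv u vu); apply: connect1; rewrite /= /quot_par vu.
Qed.

Lemma cut_comp_notin k v : k \in A -> v \in cut_comp k -> v != k -> v \notin A.
Proof.
move=> kA; rewrite inE => /eqP <-; apply: contra => vA; rewrite cut_top_id //.
Qed.

Lemma tree_on_comp k : k \in A -> tree_on (comp_par k) (cut_comp k) k.
Proof.
move=> kA; split=> [|v vk|v u vk|v]; rewrite /comp_par.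
- by rewrite inE cut_top_id.
- have [//|ne_vk] := eqVneq v k.
  apply/eqP => vN; have := cut_comp_notin kA vk ne_vk.
  by rewrite (par_None vN) rootA.
- have [//|ne_vk vu] := eqVneq v k.
  by move: (vk); rewrite !inE (cut_top_par (cut_comp_notin kA vk ne_vk) vu).
elim/(rtree_ind (T := T)): v => v IHv vk.
have [->|ne_vk] := eqVneq v k; first exact: connect0.
have vA := cut_comp_notin kA vk ne_vk.
case vu: (par T v) => [u|]; last by rewrite (par_None vu) rootA in vA.
apply: (connect_trans (y := u)); last first.
  by apply: IHv => //; move: vk; rewrite !inE (cut_top_par vA vu).
by apply: connect1; rewrite /= (negPf ne_vk) vu.
Qed.

End Cut.

(** * Isomorphisms from a graft *)

Section CutGraft.
Variables (I : finType) (S : rtree I) (W : I -> finType).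
Variables (U : forall i, rtree (W i)).

Definition block_root (i : I) : {i : I & W i} := Tagged W (root (U i)).

Lemma par_graft_root (c : graft_choice S W) i :
  par (graft U c) (block_root i) = val c i.
Proof. by rewrite /par /= ffunE /= (par_root (U i)). Qed.

Lemma par_graft_in (c : graft_choice S W) i (x y : W i) :
  par (U i) x = Some y -> par (graft U c) (Tagged W x) = Some (Tagged W y).
Proof. by move=> xy; rewrite /par /= ffunE /= -/(par _ _) xy. Qed.

Lemma graft_choiceP (c : graft_choice S W) i : omap tag (val c i) = par S i.
Proof. by apply/eqP; move/forallP: (valP c) => /(_ i). Qed.

Variables (V : finType) (T : rtree V) (A : {set V}).
Hypothesis rootA : root T \in A.

Let D := {ffun {i : I & W i} -> V}.

(** The isomorphisms under which cutting [T] at [A] undoes the grafting. *)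
Definition graft_isos (c : graft_choice S W) : {set D} :=
  [set f in embs (graft U c) (par T) [set: V]
    | f @: (block_root @: [set: I]) == A].

Lemma graft_isosP c (f : D) :
  reflect [/\ bijective f, forall x, par T (f x) = omap f (par (graft U c) x)
            & forall v, (v \in A) <-> exists i, v = f (block_root i)]
          (f \in graft_isos c).
Proof.
rewrite inE -imset_comp; apply: (iffP andP) => [[/isosP[f_bij fP] /eqP <-] | ].
  split=> // v; split=> [/imsetP[i _ ->] | [i ->]]; first by exists i.
  by apply: imset_f.
move=> [f_bij fP fA]; split; first exact/isosP.
apply/eqP/setP => v; apply/imsetP/idP => [[i _ ->] | /fA[i ->]].
  by apply/fA; exists i.
by exists i.
Qed.

(** The choice of grafting vertices can be read off the isomorphism: it is given
by the parents in [T] of the images of the grafted roots. *)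
Lemma graft_isos_inj c1 c2 f :
  f \in graft_isos c1 -> f \in graft_isos c2 -> c1 = c2.
Proof.
move=> /graft_isosP[/bij_inj f_inj f1P _] /graft_isosP[_ f2P _].
apply/val_inj/ffunP => i; have := f1P (block_root i).
by rewrite f2P !par_graft_root => /(inj_omap f_inj).
Qed.

(** Within a grafted tree only the root is sent into [A], so climbing from
[f (i, x)] until [A] is reached ends at the image of the root of [U i]. *)
Lemma top_graft c (f : D) i (x : W i) : f \in graft_isos c ->
  cut_top T A (f (Tagged W x)) = f (block_root i).
Proof.
move=> /graft_isosP[/bij_inj f_inj fP fA].
elim/(rtree_ind (T := U i)): x => x IHx.
case xy: (par (U i) x) => [y|]; last first.
  by rewrite (par_None xy) cut_top_id //; apply/fA; exists i.
rewrite -(IHx y xy); apply: cut_top_par => //; last first.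
  by rewrite fP (par_graft_in c xy).
apply/negP => /fA[j /f_inj Dj]; have /= Di := congr1 tag Dj.
move: Dj; rewrite -Di /block_root => /eqP; rewrite eq_Tagged /= => /eqP Dx.
by rewrite Dx par_root in xy.
Qed.

Lemma graft_isos_slice c (f : D) : f \in graft_isos c ->
  [ffun i => f (block_root i)] \in embs S (quot_par T A) A /\
  forall i, slice f i \in embs (U i) (comp_par T (f (block_root i)))
                                (cut_comp T A (f (block_root i))).
Proof.
move=> f_iso; have topf := top_graft _ f_iso.
have /graft_isosP[[g fK gK] fP fA] := f_iso; have f_inj := can_inj fK.
have blocks_inj i j : f (block_root i) = f (block_root j) -> i = j.
  by move/f_inj/(congr1 tag).
split.
  apply/embsP; split=> [i j | | i]; rewrite ?ffunE; first exact: blocks_inj.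
    apply/setP => v; apply/imsetP/idP => [[i _ ->] | /fA[i ->]].
      by rewrite ffunE; apply/fA; exists i.
    by exists i; rewrite ?inE ?ffunE.
  rewrite /quot_par fP par_graft_root -(graft_choiceP c).
  by case: (val c i) => //= -[j y] /=; rewrite ffunE topf.
move=> i; apply/embsP; split=> [x y | | x]; rewrite ?ffunE.
- by move/f_inj/eqP; rewrite eq_Tagged => /eqP.
- apply/setP => v; rewrite inE -(gK v); case: (g v) => j y; rewrite topf.
  apply/imsetP/eqP => [[x _] | /blocks_inj Dj].
    by rewrite ffunE => /f_inj /(congr1 tag) /= ->.
  by subst j; exists y; rewrite ?inE ?ffunE.
rewrite /comp_par (inj_eq f_inj) eq_Tagged /= -par_eq0.
case xy: (par (U i) x) => [y|] //=.
by rewrite ffunE fP (par_graft_in c xy).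
Qed.

(** Converse of [graft_isos_slice].  The components partition the vertices of
[T], so [f] is bijective; the choice [c] is the preimage under [f] of the
parents of the elements of [A], and it lies over [S] because [S] is mapped
isomorphically to the quotient. *)
Lemma slice_graft_isos (f : D) :
  [ffun i => f (block_root i)] \in embs S (quot_par T A) A ->
  (forall i, slice f i \in embs (U i) (comp_par T (f (block_root i)))
                                (cut_comp T A (f (block_root i)))) ->
  exists c, f \in graft_isos c.
Proof.
move=> /embsP[s_inj s_im sP] fL.
have blocks_inj i j : f (block_root i) = f (block_root j) -> i = j.
  by move=> eq_ij; apply: s_inj; rewrite !ffunE.
have topf i (x : W i) : cut_top T A (f (Tagged W x)) = f (block_root i).
  have /embsP[_ f_im _] := fL i.
  have: slice f i x \in cut_comp T A (f (block_root i)).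
    by rewrite -f_im imset_f.
  by rewrite inE ffunE => /eqP.
have f_inj : injective f.
  move=> [i x] [j y] eq_f; have := topf i x.
  rewrite eq_f topf => /blocks_inj Dj; subst j; congr (Tagged W _).
  have /embsP[fi_inj _ _] := fL i.
  by apply: fi_inj; rewrite !ffunE.
have fA v : (v \in A) <-> exists i, v = f (block_root i).
  rewrite -s_im; split=> [/imsetP[i _ ->] | [i ->]].
    by exists i; rewrite ffunE.
  by apply/imsetP; exists i; rewrite ?inE ?ffunE.
have f_sur v : exists x, f x == v.
  have /fA[i Dt] := cut_top_in rootA v; have /embsP[_ f_im _] := fL i.
  have: v \in cut_comp T A (f (block_root i)) by rewrite inE Dt.
  rewrite -f_im => /imsetP[x _ ->]; rewrite ffunE.
  by exists (Tagged W x).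
pose g v := xchoose (f_sur v).
have gK : cancel g f by move=> v; apply/eqP/(xchooseP (f_sur v)).
have fK : cancel f g by move=> x; apply: f_inj; rewrite gK.
pose c := [ffun i => omap g (par T (f (block_root i)))].
have cP : [forall i, omap tag (c i) == par S i].
  apply/forallP => i; apply/eqP; rewrite ffunE; apply: (inj_omap s_inj).
  rewrite -sP /quot_par ffunE; case: (par T _) => //= v.
  by rewrite ffunE -[in RHS](gK v); case: (g v) => j y; rewrite topf.
exists (Sub c cP : graft_choice S W); apply/graft_isosP; split=> //.
  by exists g.
case=> i x; case xy: (par (U i) x) => [y|]; last first.
  rewrite (par_None xy) par_graft_root SubK ffunE.
  by case: (par T _) => //= v; rewrite gK.
rewrite (par_graft_in _ xy) /=; have /embsP[_ _ /(_ x)] := fL i.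
rewrite xy /= /comp_par !ffunE; by case: ifP.
Qed.

Lemma slice_block_root (f : D) i k : k \in A ->
  slice f i \in embs (U i) (comp_par T k) (cut_comp T A k) ->
  f (block_root i) = k.
Proof.
move=> kA /embsP[_ f_im /(_ (root (U i)))].
rewrite par_root ffunE /= /comp_par; case: eqP => // ne_k /par_None Dr.
have: slice f i (root (U i)) \in cut_comp T A k by rewrite -f_im imset_f.
by rewrite inE ffunE Dr cut_top_id // => /eqP.
Qed.

Variable R : comNzRingType.

(** Both sides are the indicator of [f] being an isomorphism from a graft: the
choice [c] on the left and the embedding [s] on the right are determined by
[f]. *)
Lemma sum_choice (f : D) :
  \sum_c (f \in graft_isos c)%:R =
  \sum_(s in embs S (quot_par T A) A)
     \prod_i (slice f i \in embs (U i) (comp_par T (s i))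
                                      (cut_comp T A (s i)))%:R :> R.
Proof.
pose s0 := [ffun i => f (block_root i)].
pose L (s : {ffun I -> V}) i :=
  slice f i \in embs (U i) (comp_par T (s i)) (cut_comp T A (s i)).
have prodL s : \prod_i (L s i)%:R = [forall i, L s i]%:R :> R.
  case: forallP => [Ls | /forallP]; first by rewrite big1 // => i _; rewrite Ls.
  rewrite negb_forall => /existsP[i /negPf Li].
  by rewrite (bigD1 i) //= Li mul0r.
rewrite [RHS](eq_bigr _ (fun s _ => prodL s)).
have Ls s : s \in embs S (quot_par T A) A -> [forall i, L s i] -> s = s0.
  move=> /embsP[_ s_im _] /forallP Ls; apply/ffunP => i; rewrite ffunE.
  by apply/esym/slice_block_root; [rewrite -s_im imset_f | apply: Ls].
have [[c fc] | no_c] := pselect (exists c, f \in graft_isos c).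
  have [s0P L0] := graft_isos_slice fc.
  rewrite (bigD1 c) //= fc (bigD1 s0) //=.
  rewrite !big1 ?addr0 => [|s /andP[sP ne_s]|c' ne_c].
  - suff -> : [forall i, L s0 i] by [].
    by apply/forallP => i; rewrite /L /s0 ffunE; apply: L0.
  - case: (boolP [forall i, L s i]) => // Ls0.
    by rewrite (Ls s sP Ls0) eqxx in ne_s.
  case: (boolP (f \in graft_isos c')) => // fc'.
  by rewrite (graft_isos_inj fc' fc) eqxx in ne_c.
rewrite !big1 // => [s sP | c _]; last first.
  by case: (boolP (f \in graft_isos c)) => // fc; case: no_c; exists c.
case: (boolP [forall i, L s i]) => // Lss; case: no_c; have Ds := Ls s sP Lss.
apply: slice_graft_isos; rewrite -/s0 -?Ds // => i.
by have /forallP/(_ i) := Lss; rewrite /L Ds ffunE.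
Qed.

(** Summing [sum_choice] over all [f]: for fixed [s] the slices of [f] vary
independently, whence the product. *)
Lemma card_graft_isos :
  \sum_(c : graft_choice S W) #|graft_isos c|%:R =
  \sum_(s in embs S (quot_par T A) A)
     \prod_i #|embs (U i) (comp_par T (s i)) (cut_comp T A (s i))|%:R :> R.
Proof.
have cardE (X : finType) (B : {set X}) : #|B|%:R = \sum_x (x \in B)%:R :> R.
  rewrite -sum1_card natr_sum big_mkcond /=.
  by apply: eq_bigr => x _; case: (x \in B).
under eq_bigr do rewrite cardE.
rewrite exchange_big /=; under eq_bigr do rewrite sum_choice.
rewrite exchange_big /=; apply: eq_bigr => s _.
rewrite [RHS](eq_bigr _ (fun i _ => cardE _ _)) -sum_prod_curry.
by [].
Qed.

End CutGraft.

(** * Flows with prescribed zero rates *)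

Section CutFlows.
Variables (V : finType) (T : rtree V).

(** The rate of an edge is determined by the rates of the edges coming in below
it. *)
Lemma rate_unique f r1 r2 : is_rate T f r1 -> is_rate T f r2 -> r1 =1 r2.
Proof.
move=> r1P r2P; elim/(rtree_ind_up (T := T)) => v IHv.
rewrite r1P r2P; congr (_ + _); apply: eq_bigr => w /eqP; exact: IHv.
Qed.

(** The inputs number [n] plus the number of outputs, so the flows with a given
exit rate have bounded multiplicities. *)
Lemma flow_bound f n v : flows T n f -> (f.2 v < (n + #|V|).+1)%N.
Proof.
case=> r [_ rP _] rn; have /eqP := sum_rate rP.
rewrite rn eq_sym subr_eq -PoszD => /eqP[sm].
rewrite ltnS; apply: (@leq_trans (\sum_v f.2 v)).
  by rewrite (bigD1 v) //= leq_addr.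
by rewrite sm leq_add2l max_card.
Qed.

(** The rates of [f] vanish exactly on [A], the root being put in [A] whatever
its rate: these are the flows whose decomposition into connected flows is
obtained by cutting the edges going out of [A]. *)
Definition cut_flow (A : {set V}) (n : nat) (f : preflow V) : Prop :=
  exists r, [/\ is_flow T f r, r (root T) = n%:Z
              & forall v, (v \in A) = (v == root T) || (r v == 0)].

Definition cut_gen (A : {set V}) : fps {poly rat} :=
  Fps (fun n => \sum_(f \in (cut_flow A n : set (preflow V)))
                   ('X^#|f.1| : {poly rat})).

Lemma cut_flow_flow A n f : cut_flow A n f -> flows T n f.
Proof. by case=> r [? ? _]; exists r. Qed.

(** A connected flow is a flow for which nothing needs to be cut. *)
Lemma cflow_gen_cut : cflow_gen T = cut_gen [set root T].
Proof.
apply: fpsP => n /=; apply: eq_fsbigl; apply/seteqP; split=> f.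
  case=> r [rP r1] rn; exists r; split=> // v; rewrite inE.
  by have [//|/r1] := eqVneq v (root T); case: (r v) => [[]|].
case=> r [rP rn rA]; exists r => //; split=> // v ne_v.
have [_ _ /(_ v)] := rP; have := rA v; rewrite inE (negPf ne_v) /=.
by case: (r v) => [[]|].
Qed.

End CutFlows.

Section BoundedFlows.
Variables (N : nat).

(** Preflows with multiplicities less than [N].  They form a finite type of
functions on the vertices, so that sums over them can be reindexed along
bijections of the vertices and split over disjoint unions. *)
Definition bflow (V : finType) : finType := {ffun V -> bool * 'I_N}.

Definition unbound (V : finType) (g : bflow V) : preflow V :=
  ([set v | (g v).1], [ffun v => val (g v).2]).

Definition bflow_sum (V : finType) (P : preflow V -> Prop) : {poly rat} :=
  \sum_(g : bflow V) if `[< P (unbound g) >] then 'X^#|(unbound g).1| else 0.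

Lemma unbound_inj (V : finType) : injective (@unbound V).
Proof.
move=> g h [/setP eq1 /ffunP eq2]; apply/ffunP => v.
have := eq1 v; have := eq2 v; rewrite !inE !ffunE.
by case: (g v) (h v) => [b i] [b' i'] /= /val_inj -> ->.
Qed.

Lemma fsum_bflow (V : finType) (P : preflow V -> Prop) :
    (forall f v, P f -> (f.2 v < N)%N) ->
  \sum_(f \in (P : set (preflow V))) ('X^#|f.1| : {poly rat}) = bflow_sum P.
Proof.
move=> Pb; rewrite fsbig_mkcond (fsum_range (@unbound_inj V)).
  apply: eq_bigr => g _; rewrite /patch.
  by congr (if _ then _ else _); apply/idP/idP; rewrite inE => /asboolP.
move=> f; rewrite /patch; case: ifP; rewrite ?eqxx // inE => Pf _.
exists [ffun v => (v \in f.1, Ordinal (Pb f v Pf))].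
case: f Pf => O m Pf; congr (_, _); first by apply/setP => v; rewrite inE ffunE.
by apply/ffunP => v; rewrite !ffunE.
Qed.

Lemma cut_genE (V : finType) (T : rtree V) A n : (n + #|V| < N)%N ->
  fps_coef (cut_gen T A) n = bflow_sum (cut_flow T A n).
Proof.
move=> nN; apply: fsum_bflow => f v /cut_flow_flow /(flow_bound v).
by move/leq_trans; apply.
Qed.

End BoundedFlows.

(** Rates being unique, every flow is cut at exactly one set. *)
Lemma flow_gen_cut (V : finType) (T : rtree V) :
  flow_gen T = \sum_(A : {set V} | root T \in A) cut_gen T A.
Proof.
apply: fpsP => n; rewrite fps_coef_sum; pose N := (n + #|V|).+1.
transitivity (bflow_sum N (flows T n)).
  by apply: fsum_bflow => f v /(flow_bound v).
under [RHS]eq_bigr do rewrite (cut_genE (N := N)) //.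
rewrite exchange_big /=; apply: eq_bigr => g _.
case: asboolP => [[r rP rn] | no_flow]; last first.
  rewrite big1 // => A _; case: asboolP => // /cut_flow_flow; contradiction.
pose A0 := [set v | (v == root T) || (r v == 0)].
rewrite (bigD1 A0) ?inE ?eqxx //= asboolT; last first.
  by exists r; split=> // v; rewrite inE.
rewrite big1 ?addr0 // => A /andP[_ ne_A].
case: asboolP => // -[r' [r'P _ r'A]].
case/eqP: ne_A; apply/setP => v; rewrite inE r'A.
by case: rP r'P => _ rP _ [_ r'P _]; rewrite (rate_unique r'P rP).
Qed.

(** * Invariance of flows under isomorphism *)

Section Transport.
Variables (V W : finType).

Definition pull (f : W -> V) (F : preflow V) : preflow W :=
  ([set x | f x \in F.1], [ffun x => F.2 (f x)]).

(** The rates of the pulled back flow are the pulled back rates. *)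
Lemma cut_flow_pull (U : rtree W) (T : rtree V) (f : {ffun W -> V})
    (B : {set W}) n F :
    f \in embs U (par T) [set: V] ->
  cut_flow T (f @: B) n F -> cut_flow U B n (pull f F).
Proof.
move=> /isosP[f_bij fP] [r [[rO rP r_ge0] rn rA]]; have f_inj := bij_inj f_bij.
have f_root : f (root U) = root T by apply: par_None; rewrite fP par_root.
exists (r \o f); split=> [||x]; last 1 first.
- by have := rA (f x); rewrite mem_imset // -f_root (inj_eq f_inj).
- split=> [x | x | x]; rewrite /= ?inE ?ffunE; [exact: rO | | exact: r_ge0].
  rewrite rP; congr (_ + _); rewrite (reindex f) /=; last exact: onW_bij.
  apply: eq_bigl => y; rewrite /child fP.
  by case: (par U y) => //= z; apply/eqP/eqP => [[/f_inj ->] | [->]].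
by rewrite /= f_root.
Qed.

End Transport.

Lemma cut_gen_iso (V W : finType) (U : rtree W) (T : rtree V)
    (f : {ffun W -> V}) (B : {set W}) :
  f \in embs U (par T) [set: V] -> cut_gen U B = cut_gen T (f @: B).
Proof.
move=> f_iso; have /isosP[[g fK gK] fP] := f_iso.
have cardWV : #|W| = #|V| by apply: bij_eq_card; exists g; eassumption.
apply: fpsP => n; pose N := (n + #|V|).+1.
rewrite !(cut_genE (N := N)) ?cardWV //.
pose h (F : bflow N V) : bflow N W := [ffun x => F (f x)].
have h_bij : bijective h.
  exists (fun F : bflow N W => [ffun v => F (g v)] : bflow N V) => F;
    apply/ffunP => x.
    by rewrite !ffunE gK.
  by rewrite !ffunE fK.
have hP F : unbound (h F) = pull f (unbound F).
  congr (_, _); first by apply/setP => x; rewrite !inE ffunE.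
  by apply/ffunP => x; rewrite !ffunE.
rewrite /bflow_sum (reindex h) /=; last exact: onW_bij.
apply: eq_bigr => F _; rewrite hP.
congr (if _ then 'X^_ else _); last first.
  rewrite -(on_card_preimset (f := f)); last by apply: onW_bij; exists g.
  by congr #|pred_of_set _|; apply/setP => x; rewrite !inE ffunE.
apply/asboolP/asboolP; last exact: cut_flow_pull.
pose g' : {ffun V -> W} := finfun g.
have g'_iso : g' \in embs T (par U) [set: W].
  apply/isosP; split; first by exists f => x; rewrite ffunE.
  move=> v; rewrite ffunE -[in RHS](gK v) fP.
  by case: (par U _) => //= x; rewrite ffunE fK.
have -> : B = g' @: (f @: B).
  rewrite -imset_comp -[LHS]imset_id; apply: eq_imset => x.
  by rewrite /= ffunE fK.
move/(cut_flow_pull g'_iso).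
have -> : pull g' (pull f (unbound F)) = unbound F.
  congr (_, _); first by apply/setP => v; rewrite !inE ffunE gK.
  by apply/ffunP => v; rewrite !ffunE gK.
suff -> : f @: (g' @: (f @: B)) = f @: B by [].
rewrite -!imset_comp; apply: eq_imset => x.
by rewrite /= ffunE fK.
Qed.

(** * Flows on a graft *)

Section GraftFlows.
Variables (I : finType) (S : rtree I) (W : I -> finType).
Variables (U : forall i, rtree (W i)) (c : graft_choice S W).

(** If no grafted root sends anything out, the incoming rates of a vertex are
those coming from the tree it was taken from. *)
Lemma sum_child_graft (r : {i : I & W i} -> int) i (x : W i) :
    (forall j, j != root S -> r (block_root U j) = 0) ->
  \sum_(w | child (graft U c) w (Tagged W x)) r w
    = \sum_(y | child (U i) y x) r (Tagged W y).
Proof.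
move=> r0; pose F j (y : W j) :=
  if child (graft U c) (Tagged W y) (Tagged W x) then r (Tagged W y) else 0.
have F_root j (y : W j) : par (U j) y = None -> F j y = 0.
  move/par_None->; rewrite /F /child par_graft_root.
  have [->|/r0 ->] := eqVneq j (root S); last by rewrite if_same.
  by have := graft_choiceP c (root S); rewrite par_root; case: (val c _).
transitivity (\sum_j \sum_y F j y).
  rewrite sig_big_dep big_mkcond /=.
  by apply: eq_bigr => -[j y].
rewrite (bigD1 i) //= [X in _ + X]big1 ?addr0 => [|j ne_ji].
  rewrite [RHS]big_mkcond /=; apply: eq_bigr => y _.
  rewrite /child; case yz: (par (U i) y) => [z|]; last by rewrite F_root.
  rewrite /F /child (par_graft_in c yz); congr (if _ then _ else _).
  by rewrite (inj_eq Some_inj) eq_Tagged /= (inj_eq Some_inj).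
apply: big1 => y _; case yz: (par (U j) y) => [z|]; last exact: F_root.
rewrite /F /child (par_graft_in c yz) (inj_eq Some_inj).
by case: eqP => // /(congr1 tag) /= /eqP; rewrite (negPf ne_ji).
Qed.

(** Exit rate of the piece [i] of a flow with exit rate [n] that has been cut at
all the grafted roots. *)
Definition block_exit n (i : I) : nat := if i == root S then n else 0%N.

Lemma mem_block_roots i (x : W i) :
  (Tagged W x \in block_root U @: [set: I]) = (x == root (U i)).
Proof.
apply/imsetP/eqP => [[j _ Dx] | ->]; last by exists i.
have /= Di := congr1 tag Dx; subst j.
by move/eqP: Dx; rewrite eq_Tagged => /eqP.
Qed.

Lemma cut_flow_graft N n (f : bflow N {i : I & W i}) :
  cut_flow (graft U c) (block_root U @: [set: I]) n (unbound f) <->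
  forall i, cut_flow (U i) [set root (U i)] (block_exit n i)
              (unbound (slice f i)).
Proof.
have root_graft : root (graft U c) = block_root U (root S) by [].
split=> [[r [[rO rP r_ge0] rn rA]] i | H].
  have r0 j : j != root S -> r (block_root U j) = 0.
    move=> ne_j; have := rA (block_root U j).
    rewrite mem_block_roots eqxx root_graft.
    have -> : (block_root U j == block_root U (root S)) = false.
      by apply/eqP => /(congr1 tag) /= /eqP; rewrite (negPf ne_j).
    by move/esym/eqP.
  exists (fun x => r (Tagged W x)); split=> [||x].
  - split=> x; rewrite /= ?inE ?ffunE //.
      by have := rO (Tagged W x); rewrite /= ?inE ?ffunE.
    by rewrite rP (sum_child_graft _ r0) /= ?inE ?ffunE.
  - rewrite /block_exit; have [->|/r0] := eqVneq i (root S); last by [].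
    by rewrite -rn root_graft.
  have := rA (Tagged W x); rewrite mem_block_roots inE root_graft.
  have [->//|ne_x] := eqVneq x (root (U i)).
  have -> // : (Tagged W x == block_root U (root S)) = false.
  apply/eqP => eq_x; have /= Di := congr1 tag eq_x; subst i.
  by move/eqP: eq_x; rewrite eq_Tagged /= (negPf ne_x).
(* No flow passes between the pieces, so the rates on them glue. *)
pose r (x : {i : I & W i}) := projT1 (cid (H (tag x))) (tagged x).
have rH i : [/\ is_flow (U i) (unbound (slice f i)) (fun x => r (Tagged W x)),
    r (block_root U i) = (block_exit n i)%:Z
  & forall x, (x == root (U i)) = (x == root (U i)) || (r (Tagged W x) == 0)].
  rewrite /r /=; case: (cid _) => /= ri [riP rin riA]; split=> // x.
  by rewrite -riA inE.
have r0 j : j != root S -> r (block_root U j) = 0.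
  by move=> /negPf ne_j; have [_ -> _] := rH j; rewrite /block_exit ne_j.
exists r; split=> [||[i x]].
- split=> -[i x]; have [[rO rP r_ge0] _ _] := rH i; last exact: r_ge0.
    by have := rO x; rewrite /= ?inE ?ffunE.
  by rewrite rP (sum_child_graft _ r0) /= ?inE ?ffunE.
- by rewrite root_graft; have [_ -> _] := rH (root S); rewrite /block_exit eqxx.
rewrite mem_block_roots root_graft; have [_ _ riA] := rH i; rewrite riA.
have [-> /=|ne_x /=] := eqVneq x (root (U i)).
  have [->|/r0 ri] := eqVneq i (root S); first by rewrite eqxx.
  by apply/esym/orP; right; apply/eqP.
suff -> : (Tagged W x == block_root U (root S)) = false by [].
apply/eqP => eq_x; have /= Di := congr1 tag eq_x; subst i.
by move/eqP: eq_x; rewrite eq_Tagged /= (negPf ne_x).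
Qed.

(** Numbers of outputs add up over the pieces, so the weights multiply. *)
Lemma cut_gen_graft :
  cut_gen (graft U c) (block_root U @: [set: I]) =
  \prod_i (if i == root S then cflow_gen (U i)
           else fpsC (fps_coef (cflow_gen (U i)) 0)).
Proof.
apply: fpsP => n; pose N := (n + #|{: {i : I & W i}}|).+1.
rewrite (cut_genE (N := N)) //.
pose P i := cut_flow (U i) [set root (U i)] (block_exit n i).
transitivity (\prod_i bflow_sum N (P i)).
  rewrite /bflow_sum -[RHS]sum_prod_curry; apply: eq_bigr => f _.
  case: asboolP => [/cut_flow_graft fP | fP]; last first.
    suff [i iP] : exists i, ~ P i (unbound (slice f i)).
      by rewrite (bigD1 i) //= asboolF ?mul0r.
    by apply: contrapT => /forallNP noP; apply: fP; apply/cut_flow_graft => i;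
      apply: contrapT; apply: noP.
  under eq_bigr => i _ do rewrite (asboolT (fP i : P i _)).
  rewrite -expr_sum; congr ('X^ _); rewrite -sum1_card big_mkcond /=.
  transitivity (\sum_i \sum_(x : W i) (f (Tagged W x)).1 : nat)%N.
    rewrite sig_big_dep /=; apply: eq_bigr => -[i x] _.
    by rewrite inE /=; case: (f _).1.
  apply: eq_bigr => i _; rewrite -sum1_card [RHS]big_mkcond.
  by apply: eq_bigr => x _; rewrite inE ffunE; case: (f _).1.
have sub_card i : (#|W i| <= #|{: {i : I & W i}}|)%N.
  by rewrite card_tagged sumnE big_map big_enum (bigD1 i) //= leq_addr.
have sumE i : bflow_sum N (P i) = fps_coef (cflow_gen (U i)) (block_exit n i).
  rewrite cflow_gen_cut (cut_genE (N := N)) // ltnS leq_add ?sub_card //.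
  by rewrite /block_exit; case: ifP.
under eq_bigr do rewrite sumE.
by rewrite fps_coef_prod_at.
Qed.

End GraftFlows.

(** * Insertion of connected flows *)

Section Insertion.
Variables (I : finType) (S : rtree I).

Section Cuts.
Variables (W : I -> finType) (U : forall i, rtree (W i)).
Variables (V : finType) (T : rtree V) (c : graft_choice S W).

(** The image of the grafted roots contains the root of [T]. *)
Lemma card_isos_cuts :
  #|embs (graft U c) (par T) [set: V]|
    = (\sum_(A : {set V} | root T \in A) #|graft_isos U T A c|)%N.
Proof.
rewrite -sum1_card.
pose cut (f : {ffun {i : I & W i} -> V}) := f @: (block_root U @: [set: I]).
rewrite (partition_big cut (fun A => root T \in A)) /=; last first.
  move=> f /isosP[f_bij fP].
  have -> : root T = f (block_root U (root S)).
    by apply/esym/par_None; rewrite fP (par_root (graft U c)).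
  by rewrite /cut; do 2!apply: imset_f.
by apply: eq_bigr => A _; rewrite -sum1_card; apply: eq_bigl => f; rewrite !inE.
Qed.

(** If some isomorphism sends the grafted roots onto [A], then the flows on the
graft cut at its roots correspond to the flows on [T] cut at [A]; if none does,
then the term of [A] is zero. *)
Lemma cflow_graft_isos :
  (\prod_i (if i == root S then cflow_gen (U i)
            else fpsC (fps_coef (cflow_gen (U i)) 0)))
     * #|embs (graft U c) (par T) [set: V]|%:R
  = \sum_(A : {set V} | root T \in A) cut_gen T A * #|graft_isos U T A c|%:R.
Proof.
rewrite -(cut_gen_graft U c) card_isos_cuts natr_sum mulr_sumr.
apply: eq_bigr => A _.
have [-> | [f]] := set_0Vmem (graft_isos U T A c).
  by rewrite cards0 !mulr0.
rewrite inE => /andP[f_iso /eqP <-].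
by rewrite (cut_gen_iso _ f_iso).
Qed.

End Cuts.

(** Counting isomorphisms to [T] counts each choice [aut T] times. *)
Lemma insertion_coefE (Ts : I -> isotree) (T : isotree) :
  (insertion_coef S Ts T)%:R =
  inv_aut T * \sum_(c : graft_choice S (fun i => 'I_(nverts (Ts i))))
    #|embs (graft (fun i => rep (Ts i)) c) (par (rep T)) [set: _]|%:R
    :> fps {poly rat}.
Proof.
rewrite /insertion_coef -sum1_card natr_sum big_mkcond mulr_sumr /=.
apply: eq_bigr => c _; rewrite card_isos inE; case: asboolP => _.
  by rewrite inv_autK.
by rewrite mulr0.
Qed.

Lemma cflow_seriesE b U :
  (if b then cflow_series else cflow_series0) U
    = inv_aut U * (if b then cflow_gen (rep U)
                   else fpsC (fps_coef (cflow_gen (rep U)) 0)).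
Proof.
case: b; first by rewrite /cflow_series mulrC.
by rewrite /cflow_series0 /cflow_series fps_coefMC fpsC_mul mulrC.
Qed.

(** For a fixed set [A] the trees [Ts i] are separated: each of them enters only
its own factor, so that the sum over all [Ts] can be taken factor by factor. *)
Lemma insertion_term (Ts : I -> isotree) (T : isotree) :
  (\prod_i (if i == root S then cflow_series else cflow_series0) (Ts i))
     * (insertion_coef S Ts T)%:R
  = inv_aut T * \sum_(A : {set _} | root (rep T) \in A) cut_gen (rep T) A *
      \sum_(s in embs S (quot_par (rep T) A) A) \prod_i
        (inv_aut (Ts i) * #|embs (rep (Ts i)) (comp_par (rep T) (s i))
                                 (cut_comp (rep T) A (s i))|%:R).
Proof.
rewrite insertion_coefE mulrCA; congr (_ * _).
under eq_bigr do rewrite cflow_seriesE.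
rewrite big_split -mulrA mulr_sumr.
rewrite [X in _ * X](eq_bigr _ (fun c _ =>
  cflow_graft_isos (fun i => rep (Ts i)) (rep T) c)).
rewrite exchange_big mulr_sumr /=; apply: eq_bigr => A rA.
rewrite -mulr_sumr (card_graft_isos _ _ rA) mulrCA mulr_sumr; congr (_ * _).
by apply: eq_bigr => s _; rewrite big_split.
Qed.

End Insertion.

Lemma isotree_enum n : exists (J : finType) (g : J -> isotree),
  injective g /\ forall U, (nverts U <= n)%N <-> exists j, U = g j.
Proof.
have /finite_seqP[s sP] := finite_nverts n.
have memP U : (nverts U <= n)%N = (U \in s) :> Prop.
  exact: (congr1 (fun P => P U) sP).
exists (seq_sub s), val; split=> [|U]; first exact: val_inj.
rewrite memP; split=> [Us | [j ->]]; first by exists (SeqSub Us).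
exact: valP.
Qed.

(** The sum over the tree inserted at [i] is [1] by [sum_embs], applied to the
component of [T] rooted at [s i]. *)
Lemma insertion_sum (I : finType) (S : rtree I) (T : isotree) :
  insertion S (fun i => if i == root S then cflow_series else cflow_series0) T
  = inv_aut T * \sum_(A : {set _} | root (rep T) \in A)
      cut_gen (rep T) A * #|embs S (quot_par (rep T) A) A|%:R.
Proof.
have [J [g [g_inj gP]]] := isotree_enum (nverts T).
pose h (t : {ffun I -> J}) : {ffun I -> isotree} := [ffun i => g (t i)].
have h_inj : injective h.
  move=> t u /ffunP eq_h; apply/ffunP => i; have := eq_h i.
  by rewrite !ffunE => /g_inj.
rewrite /insertion (fsum_range h_inj); last first.
  move=> Ts nz; have: insertion_coef S Ts T != 0%N.
    by apply: contraNneq nz => ->; rewrite mulr0.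
  move/insertion_coef_nverts => nT.
  have /fintype.fin_all_exists[t tP] i : exists j, Ts i = g j.
    by apply/gP; rewrite nT (bigD1 i) //= leq_addr.
  by exists (finfun t); apply/ffunP => i; rewrite !ffunE.
under eq_bigr do rewrite insertion_term.
rewrite -mulr_sumr exchange_big /=; congr (_ * _); apply: eq_bigr => A rA.
rewrite -mulr_sumr exchange_big /=; congr (_ * _).
rewrite -sum1_card natr_sum; apply: eq_bigr => s /embsP[_ s_im _].
pose k i U : fps {poly rat} :=
  inv_aut U * #|embs (rep U) (comp_par (rep T) (s i))
                             (cut_comp (rep T) A (s i))|%:R.
transitivity (\prod_i \sum_j k i (g j)).
  rewrite bigA_distr_bigA; apply: eq_bigr => t _.
  by apply: eq_bigr => i _; rewrite ffunE.
apply: big1 => i _; apply: (sum_embs g_inj (k := s i)).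
  move=> U Un; apply/gP; apply: leq_trans Un _.
  by rewrite -[leqRHS]card_ord max_card.
by apply: tree_on_comp => //; rewrite -s_im imset_f.
Qed.

(** * Summing over all trees *)

Theorem theorem3p4 :
  flow_series = diamond tree_series cflow_series cflow_series0.
Proof.
apply/funext => T; rewrite /diamond /tree_series.
have [J [g [g_inj gP]]] := isotree_enum (nverts T).
rewrite (fsum_range g_inj); last first.
  move=> S nz; apply/gP; rewrite leqNgt; apply: contraNN nz => ltS.
  by rewrite insertion0 ?mulr0 // card_ord.
under eq_bigr do rewrite insertion_sum mulrCA.
rewrite -mulr_sumr /flow_series mulrC flow_gen_cut; congr (_ * _).
under [RHS]eq_bigr do rewrite mulr_sumr.
rewrite exchange_big /=; apply: eq_bigr => A rA.
under eq_bigr do rewrite mulrCA.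
rewrite -mulr_sumr (sum_embs g_inj (k := root (rep T))) ?mulr1 //.
  move=> U Un; apply/gP; apply: leq_trans Un _.
  by rewrite -[leqRHS]card_ord max_card.
exact: tree_on_quot.
Qed.
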